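(* There is a $\mathcal{B}c^\circ$-formula $\varphi$ which is satisfiable over $\mathrm{RC}(\mathbb{R}^2)$, but which is not satisfied by any interpretation over $\mathrm{RC}(\mathbb{R}^2)$ in which every variable is assigned a region with finitely many connected components.
   Context: For a topological space $T$ and $X\subseteq T$, $\overline{X}$ is the closure and $X^\circ$ the interior of $X$; $X$ is regular closed if $X=\overline{X^\circ}$. $\mathrm{RC}(T)$ is the set of regular closed subsets of $T$ (''regions''); it is a Boolean algebra with $X+Y=X\cup Y$, $X\cdot Y=\overline{(X\cap Y)^\circ}$, $-X=\overline{T\setminus X}$, $0=\emptyset$, $1=T$. Terms are built from countably many variables $r_1,r_2,\dots$ and the constants $0,1$ using $+,\cdot,-$. $\mathcal{B}c^\circ$-formulas are built from atomic formulas $\tau_1=\tau_2$ and $c^\circ(\tau)$ using $\wedge$ and $\neg$ (there is no contact predicate). An interpretation $\mathfrak I$ over $\mathrm{RC}(T)$ assigns to each variable an element of $\mathrm{RC}(T)$ and is extended to terms via the Boolean operations; $\mathfrak I\models\tau_1=\tau_2$ iff $\tau_1^{\mathfrak I}=\tau_2^{\mathfrak I}$; $\mathfrak I\models c^\circ(\tau)$ iff the interior $(\tau^{\mathfrak I})^\circ$ is connected; connectives as usual. A formula is satisfiable over $\mathrm{RC}(T)$ if some interpretation over $\mathrm{RC}(T)$ satisfies it. *)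

(* Defs.v *)
From HB Require Import structures.
From mathcomp Require Import all_boot all_order all_algebra.
From mathcomp Require Import mathcomp_extra boolp classical_sets functions.
From mathcomp Require Import cardinality reals topology normedtype.

Set Implicit Arguments.
Unset Strict Implicit.
Unset Printing Implicit Defensive.
Import Order.TTheory GRing.Theory Num.Theory.
Import numFieldNormedType.Exports.
Local Open Scope classical_set_scope.

(* [TVar n] is the variable r_(n+1). *)
Inductive term : Type :=
| TVar of nat
| TZero
| TOne
| TAdd of term & term
| TMul of term & term
| TOpp of term.

(* The language Bc°: Boolean region terms, equality and the predicate c°
   ("the interior is connected"); there is no contact predicate. *)
Inductive formula : Type :=
| FEq of term & term
| FIntConn of term
| FAnd of formula & formula
| FNot of formula.

Section Semantics.
Variable T : topologicalType.

Definition RC : set (set T) := [set X | regclosed X].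

Definition rc_add (X Y : set T) : set T := X `|` Y.
Definition rc_mul (X Y : set T) : set T := closure (X `&` Y)°.
Definition rc_opp (X : set T) : set T := closure (~` X).

Definition interpretation_over_RC (I : nat -> set T) : Prop :=
  forall n, RC (I n).

Fixpoint term_val (I : nat -> set T) (t : term) : set T :=
  match t with
  | TVar n => I n
  | TZero => set0
  | TOne => setT
  | TAdd t1 t2 => rc_add (term_val I t1) (term_val I t2)
  | TMul t1 t2 => rc_mul (term_val I t1) (term_val I t2)
  | TOpp t1 => rc_opp (term_val I t1)
  end.

(* [connected] holds of the empty set, so c°(0) is true. *)
Fixpoint satisfies (I : nat -> set T) (phi : formula) : Prop :=
  match phi with
  | FEq t1 t2 => term_val I t1 = term_val I t2
  | FIntConn t => connected (term_val I t)°
  | FAnd phi1 phi2 => satisfies I phi1 /\ satisfies I phi2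
  | FNot phi1 => ~ satisfies I phi1
  end.

Definition satisfiable_over_RC (phi : formula) : Prop :=
  exists I : nat -> set T, interpretation_over_RC I /\ satisfies I phi.

Definition connected_components (X : set T) : set (set T) :=
  [set connected_component X x | x in X].

Definition finitely_many_components (X : set T) : Prop :=
  finite_set (connected_components X).

Lemma regclosed_closed (X : set T) : regclosed X -> closed X.
Proof. by move=> <-; exact: closed_closure. Qed.

Lemma term_val_RC (I : nat -> set T) (t : term) :
  interpretation_over_RC I -> RC (term_val I t).
Proof.
move=> IRC; elim: t => [n|||t1 R1 t2 R2|t1 _ t2 _|t R] /=.
- exact: IRC.
- by rewrite /RC /= /regclosed interior0 closure0.
- by rewrite /RC /= /regclosed interiorT closureT.
- rewrite /RC /= /regclosed eqEsubset; split.
    have cl : closed (rc_add (term_val I t1) (term_val I t2)).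
      by apply: closedU; exact: regclosed_closed.
    rewrite [X in _ `<=` X](iffLR (closure_id _) cl).
    by apply: closureS; exact: interior_subset.
  rewrite /rc_add -[X in X `|` _ `<=` _]R1 -[X in _ `|` X `<=` _]R2 -closureU.
  by apply: closureS; exact: interiorU.
- exact/closure_open_regclosed/open_interior.
- apply/closure_open_regclosed/closed_openC.
  exact: regclosed_closed.
Qed.

End Semantics.

Arguments RC : clear implicits.
Arguments satisfiable_over_RC : clear implicits.

(* Main.v *)
Require Import Defs.
From HB Require Import structures.
From mathcomp Require Import all_boot all_order all_algebra.
From mathcomp Require Import mathcomp_extra boolp classical_sets functions.
From mathcomp Require Import cardinality reals topology normedtype.
From mathcomp Require Import zify ring lra.
Import numFieldNormedType.Exports.

(** The formula speaks of disjoint regions [a], [b], [r], [s], [w] and a part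
    [z] of [w], such that each of [a], [b] together with each of [r], [s], [w]
    has connected interior.  In the intended model the components of [r] and
    [s] are vertical strips running from [b] up to [a], which alternate and
    accumulate at the left side of [z].

    The remaining conjuncts say that [z] meets [r + s] inside the interior of
    [z + r + s], but meets neither [b + r] inside the interior of [b + r + z]
    nor [b + s] inside the interior of [b + s + z].  This produces a point [p]
    common to [z], [r] and [s].  If [r] and [s] had finitely many components,
    the components through [p] would contain interior points of [r] and [s].
    Joining [p], a point of [a] and a point of [b] to these points and to a
    point of [z] draws the graph K_{3,3} in the plane in such a way that
    independent edges are disjoint, which the Hanani-Tutte parity argument
    forbids. *)

Set Implicit Arguments.
Unset Strict Implicit.
Unset Printing Implicit Defensive.
Import Order.TTheory GRing.Theory Num.Theory.
Local Open Scope classical_set_scope.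

(** * Parity count for K_{3,3} *)

(** Over the 18 instances each [N] and each [M] term occurs twice, each [A] term six times and each
    [C] term four times. Each [B j l] with [j != l] occurs three times, so the [B] terms add up to
    9, and the total is odd. *)
Lemma K33_parity (N M : nat -> nat -> nat -> nat) (A B C : nat -> nat -> nat) :
  (B 1 0 + B 0 1 = 1 -> B 2 0 + B 0 2 = 1 -> B 2 1 + B 1 2 = 1 ->
  ~ (forall i j k l, (i < k < 3) -> (j < 3) -> (l < 3) -> j != l ->
    ~~ odd (N i j k + M i j l + N k l i + M k l j + A i k + C k j + C i l + B j l + 1)))%N.
Proof.
move=> B1 B2 B3 E.
have even i j k l : i < k < 3 -> j < 3 -> l < 3 -> j != l ->
    exists h, N i j k + M i j l + N k l i + M k l j + A i k + C k j + C i l + B j l + 1 = h + h.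
  move=> ik j3 l3 jl; have := E i j k l ik j3 l3 jl.
  by move=> /even_halfK <-; eexists; rewrite -addnn.
have [? ?] := even 0 0 1 1 isT isT isT isT.
have [? ?] := even 0 0 1 2 isT isT isT isT.
have [? ?] := even 0 1 1 0 isT isT isT isT.
have [? ?] := even 0 1 1 2 isT isT isT isT.
have [? ?] := even 0 2 1 0 isT isT isT isT.
have [? ?] := even 0 2 1 1 isT isT isT isT.
have [? ?] := even 0 0 2 1 isT isT isT isT.
have [? ?] := even 0 0 2 2 isT isT isT isT.
have [? ?] := even 0 1 2 0 isT isT isT isT.
have [? ?] := even 0 1 2 2 isT isT isT isT.
have [? ?] := even 0 2 2 0 isT isT isT isT.
have [? ?] := even 0 2 2 1 isT isT isT isT.
have [? ?] := even 1 0 2 1 isT isT isT isT.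
have [? ?] := even 1 0 2 2 isT isT isT isT.
have [? ?] := even 1 1 2 0 isT isT isT isT.
have [? ?] := even 1 1 2 2 isT isT isT isT.
have [? ?] := even 1 2 2 0 isT isT isT isT.
have [? ?] := even 1 2 2 1 isT isT isT isT.
clear E even; lia.
Qed.

Local Open Scope ring_scope.

(** * Crossing parities of two disjoint segments *)

Section Plane.
Variable R : realType.
Implicit Types (x y q : R * R) (s t : seq (R * R)) (m : R).

Definition seg_pt x y (t : R) : R * R :=
  (x.1 + t * (y.1 - x.1), x.2 + t * (y.2 - x.2)).

Definition seg x y : set (R * R) := [set seg_pt x y t | t in `[0, 1]].

(** The slope [m] will be chosen generically, so that distinct points among finitely many given ones
    have distinct abscissas. *)
Definition shear m q : R := q.1 + m * q.2.

Definition height m x y (c : R) : R :=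
  x.2 + (c - shear m x) / (shear m y - shear m x) * (y.2 - x.2).

(* In the coordinates [(shear m q, q.2)], the segment from [x] to [y] meets the
   upward ray from [q].  When [shear m x = shear m y] the height is a junk value,
   but then the first conjunct is false. *)
Definition crosses m x y q : bool :=
  ((shear m x < shear m q) (+) (shear m y < shear m q)) &&
  (q.2 < height m x y (shear m q)).

Lemma seg_left x y : seg x y x.
Proof.
exists 0; first by rewrite /= in_itv /= lexx ler01.
by case: x => a b; rewrite /seg_pt /= !mul0r !addr0.
Qed.

Lemma seg_right x y : seg x y y.
Proof.
exists 1; first by rewrite /= in_itv /= lexx ler01.
by case: x y => a b [c d]; rewrite /seg_pt /=; congr pair; ring.
Qed.

Lemma seg_sym x y : seg x y = seg y x.
Proof.
suff sub a b : seg a b `<=` seg b a by apply/seteqP; split; exact: sub.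
move=> z [c cI <-]; move: cI; rewrite /= in_itv /= => cI.
exists (1 - c); first by rewrite /= in_itv /=; lra.
by rewrite /seg_pt; congr pair; ring.
Qed.

Lemma height_sym m x y c :
  shear m x != shear m y -> height m y x c = height m x y c.
Proof.
move=> xy; rewrite /height; field.
by rewrite !subr_eq0 xy eq_sym xy.
Qed.

Lemma crosses_sym m x y q :
  shear m x != shear m y -> crosses m y x q = crosses m x y q.
Proof. by move=> xy; rewrite /crosses addbC height_sym. Qed.

Lemma height_left m x y : height m x y (shear m x) = x.2.
Proof. by rewrite /height subrr !mul0r addr0. Qed.

Lemma height_right m x y :
  shear m x != shear m y -> height m x y (shear m y) = y.2.
Proof.
move=> xy; rewrite /height divff ?subr_eq0 1?eq_sym //.
by rewrite mul1r addrC subrK.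
Qed.

Lemma seg_height m x y c : shear m x < shear m y ->
  shear m x <= c <= shear m y ->
  seg x y (c - m * height m x y c, height m x y c).
Proof.
move=> xy /andP[xc cy]; have d0 : 0 < shear m y - shear m x by rewrite subr_gt0.
exists ((c - shear m x) / (shear m y - shear m x)).
  rewrite /= in_itv /=; apply/andP; split.
    by rewrite divr_ge0 // ?subr_ge0 // ltW.
  by rewrite ler_pdivrMr // mul1r lerD2r.
rewrite /seg_pt -/(height m x y c); congr pair.
by rewrite /height /shear; field; move: d0; rewrite /shear => /gt_eqF /negbT.
Qed.

(** The only root of a non-constant affine function is outside the interval, so both ends lie on the
    same side of it. *)
Lemma affine_sign (A B lo hi : R) : lo <= hi ->
  (forall c, lo <= c <= hi -> A + B * c != 0) ->
  (0 < A + B * lo) = (0 < A + B * hi).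
Proof.
move=> lohi nz.
have nlo : A + B * lo != 0 by apply: nz; rewrite lexx.
have nhi : A + B * hi != 0 by apply: nz; rewrite lexx andbT.
have [b0|B0] := eqVneq B 0; first by rewrite b0 !mul0r.
have [r AE] : exists r, A = - (B * r) by exists (- A / B); field.
have rI : ~ (lo <= r <= hi).
  by move=> /nz; rewrite AE addrC subrr eqxx.
rewrite AE -!mulrN addrC -mulrDr [X in _ = (_ < X)]addrC -mulrDr.
have [lr|rl] := ltP r lo.
  have h : 0 < lo - r by rewrite subr_gt0.
  have h' : 0 < hi - r by rewrite subr_gt0 (lt_le_trans lr).
  by rewrite !pmulr_lgt0.
have h' : r - hi > 0 by rewrite subr_gt0 ltNge; apply/negP => rh; apply: rI; rewrite rl.
have h : r - lo > 0 by move: h'; rewrite !subr_gt0; exact: le_lt_trans.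
rewrite -(opprB r lo) -(opprB r hi) !mulrN !oppr_gt0.
by rewrite !pmulr_llt0.
Qed.

(** The difference of the heights is affine in [c], and a zero over the common shadow would be a
    common point of the segments. *)
Lemma height_cmp m x x' y y' lo hi :
  seg x x' `&` seg y y' = set0 ->
  shear m x < shear m x' -> shear m y < shear m y' ->
  shear m x <= lo -> shear m y <= lo -> lo <= hi ->
  hi <= shear m x' -> hi <= shear m y' ->
  exists b : bool, forall c, c = lo \/ c = hi ->
    (height m y y' c < height m x x' c) = b /\
    (height m x x' c < height m y y' c) = ~~ b.
Proof.
move=> dis xx yy xlo ylo lohi hix hiy.
have ne c : lo <= c <= hi -> height m x x' c != height m y y' c.
  move=> /andP[lc ch]; apply/eqP => e.
  suff : (seg x x' `&` seg y y') (c - m * height m x x' c, height m x x' c).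
    by rewrite dis.
  split; first by apply: seg_height; rewrite // (le_trans xlo) //= (le_trans ch).
  by rewrite e; apply: seg_height; rewrite // (le_trans ylo) //= (le_trans ch).
have [A [B AB]] : exists A B, forall c,
    height m x x' c - height m y y' c = A + B * c.
  rewrite /height.
  set dx := (shear m x' - shear m x)^-1; set dy := (shear m y' - shear m y)^-1.
  exists (x.2 - y.2 - shear m x * dx * (x'.2 - x.2)
     + shear m y * dy * (y'.2 - y.2)),
   ((x'.2 - x.2) * dx - (y'.2 - y.2) * dy).
  by move=> c; move: (shear m x) (shear m y) => u v; ring.
have H : (height m y y' lo < height m x x' lo) = (height m y y' hi < height m x x' hi).
  rewrite -!(subr_gt0 (height m y y' _)) !AB; apply: affine_sign => // c cI.
  by rewrite -AB subr_eq0 ne.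
exists (height m y y' lo < height m x x' lo) => c ce.
have cI : lo <= c <= hi by case: ce => ->; rewrite lexx lohi.
have -> : (height m y y' c < height m x x' c) = (height m y y' lo < height m x x' lo).
  by case: ce => ->.
split=> //; rewrite -[RHS]leNgt.
have -> : (height m x x' lo <= height m y y' lo) = ~~ (height m y y' c < height m x x' c).
  by rewrite leNgt; case: ce => ->; rewrite ?H.
by rewrite -leNgt le_eqVlt (negbTE (ne c _)).
Qed.

(* Of two disjoint segments, one lies above the other over the common part of
   their shadows; whichever it is, the endpoints below it number, modulo 2, one
   exactly when the shadows interleave. *)
Lemma crosses_segs_lt m x x' y y' :
  seg x x' `&` seg y y' = set0 ->
  shear m x < shear m x' -> shear m y < shear m y' ->
  shear m x != shear m y -> shear m x != shear m y' ->
  shear m x' != shear m y -> shear m x' != shear m y' ->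
  crosses m x x' y (+) crosses m x x' y' (+)
    (crosses m y y' x (+) crosses m y y' x') =
  (shear m x < shear m y) (+) (shear m x' < shear m y) (+)
    ((shear m x < shear m y') (+) (shear m x' < shear m y')).
Proof.
move=> dis xx yy xy xy' x'y x'y'.
have nx : shear m x != shear m x' by rewrite lt_eqF.
have ny : shear m y != shear m y' by rewrite lt_eqF.
have C lo hi := @height_cmp m x x' y y' lo hi dis xx yy.
rewrite /crosses.
(* Orders with disjoint shadows are settled by computation and inconsistent ones by [lra]. In the
   four orders left, [lo] and [hi] are the ends of the overlap. *)
case: (ltgtP (shear m x) (shear m y)) xy => // h1 _;
case: (ltgtP (shear m x) (shear m y')) xy' => // h2 _;
case: (ltgtP (shear m x') (shear m y)) x'y => // h3 _;
case: (ltgtP (shear m x') (shear m y')) x'y' => // h4 _ //=;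
  try by exfalso; clear dis C; lra.
- have [b bE] := C (shear m y) (shear m x') (ltW h1) (lexx _) (ltW h3) (lexx _) (ltW h4).
  have [] := bE _ (or_introl erefl); have [] := bE _ (or_intror erefl).
  by rewrite !height_left !height_right // => e1 e2 e3 e4; rewrite ?e1 ?e2 ?e3 ?e4; case: (b).
- have [b bE] := C (shear m y) (shear m y') (ltW h1) (lexx _) (ltW yy) (ltW h4) (lexx _).
  have [] := bE _ (or_introl erefl); have [] := bE _ (or_intror erefl).
  by rewrite !height_left !height_right // => e1 e2 e3 e4; rewrite ?e1 ?e2 ?e3 ?e4; case: (b).
- have [b bE] := C (shear m x) (shear m x') (lexx _) (ltW h1) (ltW xx) (lexx _) (ltW h4).
  have [] := bE _ (or_introl erefl); have [] := bE _ (or_intror erefl).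
  by rewrite !height_left !height_right // => e1 e2 e3 e4; rewrite ?e1 ?e2 ?e3 ?e4; case: (b).
- have [b bE] := C (shear m x) (shear m y') (lexx _) (ltW h1) (ltW h2) (ltW h4) (lexx _).
  have [] := bE _ (or_introl erefl); have [] := bE _ (or_intror erefl).
  by rewrite !height_left !height_right // => e1 e2 e3 e4; rewrite ?e1 ?e2 ?e3 ?e4; case: (b).
Qed.

(** Injectivity still lets the ends of one segment coincide, in which case all terms cancel. Ends of
    different segments are distinct by disjointness, and reversing a segment permutes the terms on
    both sides. *)
Lemma crosses_segs m x x' y y' :
  seg x x' `&` seg y y' = set0 ->
  {in [:: x; x'; y; y'] &, injective (shear m)} ->
  crosses m x x' y (+) crosses m x x' y' (+)
    (crosses m y y' x (+) crosses m y y' x') =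
  (shear m x < shear m y) (+) (shear m x' < shear m y) (+)
    ((shear m x < shear m y') (+) (shear m x' < shear m y')).
Proof.
move=> dis inj.
have ne a b : seg x x' a -> seg y y' b ->
    a \in [:: x; x'; y; y'] -> b \in [:: x; x'; y; y'] -> shear m a != shear m b.
  move=> xa yb ia ib; apply/eqP => /(inj _ _ ia ib) ab.
  by have : (seg x x' `&` seg y y') a; [split=> //; rewrite ab | rewrite dis].
have mem4 := (in_cons, eqxx, orbT).
have nxy : shear m x != shear m y.
  by apply: (ne _ _ (seg_left _ _) (seg_left _ _)); rewrite ?mem4.
have nxy' : shear m x != shear m y'.
  by apply: (ne _ _ (seg_left _ _) (seg_right _ _)); rewrite ?mem4.
have nx'y : shear m x' != shear m y.
  by apply: (ne _ _ (seg_right _ _) (seg_left _ _)); rewrite ?mem4.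
have nx'y' : shear m x' != shear m y'.
  by apply: (ne _ _ (seg_right _ _) (seg_right _ _)); rewrite ?mem4.
have crosses0 a q : crosses m a a q = false by rewrite /crosses addbb.
have [xx|xx] := eqVneq (shear m x) (shear m x').
  by rewrite (inj x x') ?mem4 // !crosses0 /= !addbb.
have [yy|yy] := eqVneq (shear m y) (shear m y').
  by rewrite (inj y y') ?mem4 // !crosses0 !addbb.
wlog lx : x x' dis xx {inj ne} nxy nxy' nx'y nx'y' / shear m x < shear m x'.
  move=> W; case: (ltgtP (shear m x) (shear m x')) (xx) => // h _.
    exact: W.
  rewrite -!(crosses_sym _ xx) [crosses m y y' x (+) _]addbC.
  rewrite [(shear m x < shear m y) (+) _]addbC [(shear m x < shear m y') (+) _]addbC.
  by apply: W => //; [rewrite seg_sym|rewrite eq_sym].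
wlog ly : y y' dis yy nxy nxy' nx'y nx'y' / shear m y < shear m y'.
  move=> W; case: (ltgtP (shear m y) (shear m y')) (yy) => // h _.
    exact: W.
  rewrite -!(crosses_sym _ yy) [crosses m x x' y (+) _]addbC [RHS]addbC.
  by apply: W => //; [rewrite (seg_sym y')|rewrite eq_sym].
exact: crosses_segs_lt.
Qed.

(** * Polylines and the non-planarity of K_{3,3} *)

Definition edges x s : seq ((R * R) * (R * R)) := pairmap pair x s.

(** For empty [s] this is the empty set and does not contain [x], whence the conditions [s != [::]]
    below. *)
Definition polyline x s : set (R * R) :=
  [set q | exists2 e, e \in edges x s & seg e.1 e.2 q].

Definition crossings m x s q : bool :=
  \big[addb/false]_(e <- edges x s) crosses m e.1 e.2 q.

Lemma mem_edges x s e :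
  e \in edges x s -> (e.1 \in x :: s) && (e.2 \in x :: s).
Proof.
elim: s x => // y s IH x; rewrite /= in_cons => /orP[/eqP -> /=|/IH /andP[]].
  by rewrite !in_cons !eqxx orbT.
by rewrite !in_cons => -> ->; rewrite !orbT.
Qed.

(** Telescoping modulo 2: an inner vertex belongs to two consecutive edges. *)
Lemma big_addb_edges (f : R * R -> bool) x s :
  \big[addb/false]_(e <- edges x s) (f e.1 (+) f e.2) = f x (+) f (last x s).
Proof.
elim: s x => [|y s IH] x; first by rewrite big_nil addbb.
by rewrite /= big_cons -/(edges y s) IH /= addbA addbK.
Qed.

(** Sum [crosses_segs] over all pairs of edges; by telescoping only the ends of the polylines
    survive. *)
Lemma crossings_polylines m x s y t :
  polyline x s `&` polyline y t = set0 ->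
  {in x :: s ++ y :: t &, injective (shear m)} ->
  crossings m x s y (+) crossings m x s (last y t) (+)
    (crossings m y t x (+) crossings m y t (last x s)) =
  (shear m x < shear m y) (+) (shear m (last x s) < shear m y) (+)
    ((shear m x < shear m (last y t)) (+) (shear m (last x s) < shear m (last y t))).
Proof.
move=> dis inj.
transitivity (\big[addb/false]_(e <- edges x s) \big[addb/false]_(d <- edges y t)
   ((crosses m e.1 e.2 d.1 (+) crosses m e.1 e.2 d.2) (+)
    (crosses m d.1 d.2 e.1 (+) crosses m d.1 d.2 e.2))).
  under eq_bigr do rewrite big_split /=.
  rewrite big_split /=; congr addb.
    under [RHS]eq_bigr do rewrite (big_addb_edges (crosses m _ _)).
    by rewrite big_split.
  rewrite exchange_big /=.
  under [RHS]eq_bigr do rewrite (big_addb_edges (crosses m _ _)).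
  by rewrite big_split.
rewrite -(big_addb_edges (fun q => shear m q < shear m y)).
rewrite -(big_addb_edges (fun q => shear m q < shear m (last y t))) -big_split /=.
rewrite !big_seq; apply: eq_bigr => e eI.
rewrite -(big_addb_edges (fun q => (shear m e.1 < shear m q) (+) (shear m e.2 < shear m q))).
rewrite !big_seq; apply: eq_bigr => d dI.
apply: crosses_segs.
  rewrite -subset0 -dis => q [eq dq]; split; [by exists e|by exists d].
apply: sub_in2 inj => q; rewrite !in_cons mem_cat.
have /andP[] := mem_edges eI; have /andP[] := mem_edges dI; rewrite !in_cons.
move=> d1 d2 e1 e2; rewrite in_nil orbF.
by case/or4P => /eqP ->; rewrite ?orbA ?e1 ?e2 //; rewrite -orbA ?d1 ?d2 !orbT.
Qed.

(** Points with different second coordinates get equal shears for one slope only, and [m] exceeds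
    the sum of the absolute values of these bad slopes. *)
Lemma generic_shear s : exists m, {in s &, injective (shear m)}.
Proof.
pose bad := [seq (x.1 - y.1) / (y.2 - x.2) | x <- s, y <- s].
pose m := 1 + \sum_(c <- bad) `|c|.
have mbad : m \notin bad.
  apply/negP => mI; suff : m <= \sum_(c <- bad) `|c| by rewrite /m; lra.
  rewrite (big_rem m mI) /= (le_trans (ler_norm m)) // lerDl.
  by apply: sumr_ge0.
exists m => x y xs ys; rewrite /shear => e.
have [e2|ne2] := eqVneq x.2 y.2.
  move: e; rewrite e2 => /addIr e1.
  by rewrite (surjective_pairing x) e1 e2 -surjective_pairing.
case/negP: mbad; have -> : m = (x.1 - y.1) / (y.2 - x.2).
  have d0 : y.2 - x.2 != 0 by rewrite subr_eq0 eq_sym.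
  by apply: (mulIf d0); rewrite divfK //; lra.
exact: allpairs_f.
Qed.

Lemma polyline_head x s : s != [::] -> polyline x s x.
Proof.
case: s => // y s _; exists (x, y); last exact: seg_left.
by rewrite /= in_cons eqxx.
Qed.

Lemma polyline_last x s : s != [::] -> polyline x s (last x s).
Proof.
elim: s x => // y [|z s] IH x _.
  by exists (x, y); [rewrite /= in_cons eqxx|exact: seg_right].
have [e eI eq] := IH y isT; exists e => //.
by rewrite /= in_cons -/(edges y (z :: s)) eI orbT.
Qed.

(* The Hanani-Tutte argument: summed over the 18 pairs of independent edges,
   every crossing parity occurs twice, while the comparisons of endpoints add
   up to an odd number. *)
Lemma K33_not_planar (v w : nat -> R * R) (s : nat -> nat -> seq (R * R)) :
  (forall i j, (i < 3)%N -> (j < 3)%N -> s i j != [::] /\ last (v i) (s i j) = w j) ->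
  ~ (forall i j k l, (i < k < 3)%N -> (j < 3)%N -> (l < 3)%N -> j != l ->
       polyline (v i) (s i j) `&` polyline (v k) (s k l) = set0).
Proof.
move=> sE dis.
pose pts := flatten [seq v i :: s i j | i <- iota 0 3, j <- iota 0 3].
have [m inj] := generic_shear pts.
have sub i j : (i < 3)%N -> (j < 3)%N -> {subset v i :: s i j <= pts}.
  move=> i3 j3 q qI; apply/flattenP; exists (v i :: s i j) => //.
  by apply: allpairs_f; rewrite mem_iota.
pose N i j k : bool := crossings m (v i) (s i j) (v k).
pose M i j l : bool := crossings m (v i) (s i j) (w l).
pose A i k : bool := shear m (v i) < shear m (v k).
pose B j l : bool := shear m (w j) < shear m (w l).
pose C i l : bool := shear m (v i) < shear m (w l).
have E i j k l : (i < k < 3)%N -> (j < 3)%N -> (l < 3)%N -> j != l ->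
    ~~ odd (N i j k + M i j l + N k l i + M k l j + A i k + C k j + C i l + B j l + 1)%N.
  move=> ik j3 l3 jl; have /andP[ltik k3] := ik; have i3 := ltn_trans ltik k3.
  have [nij lij] := sE i j i3 j3; have [nkl lkl] := sE k l k3 l3.
  have D := dis i j k l ik j3 l3 jl.
  have inj' : {in v i :: s i j ++ v k :: s k l &, injective (shear m)}.
    apply: sub_in2 inj => q; rewrite -cat_cons mem_cat => /orP[]; exact: sub.
  have := crossings_polylines D inj'; rewrite lij lkl -/(N i j k) -/(M i j l).
  rewrite -/(N k l i) -/(M k l j) -/(A i k) -/(C i l) -/(B j l).
  (* Reversing this comparison yields the summand 1 in [E]. Equality would put a common point on two
     disjoint polylines. *)
  have -> : (shear m (w j) < shear m (v k)) = ~~ C k j.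
    rewrite /C -leNgt le_eqVlt; case: eqP => //= e.
    have jI : w j \in pts by apply: (sub i j i3 j3); rewrite -lij mem_last.
    have kI : v k \in pts by apply: (sub k l k3 l3); rewrite mem_head.
    have := inj _ _ jI kI e => wv.
    suff : (polyline (v i) (s i j) `&` polyline (v k) (s k l)) (w j) by rewrite D.
    split; first by rewrite -lij; exact: polyline_last.
    by rewrite wv; exact: polyline_head.
  rewrite !oddD; move: (N _ _ _) (M _ _ _) (N _ _ _) (M _ _ _) (A _ _) (C _ _) (C _ _) (B _ _).
  by do 8! case.
(* The points [w j] and [w l] are distinct because they end disjoint polylines from [v 0] and
   [v 1]. *)
have Bsym j l : (j < l < 3)%N -> B l j = ~~ B j l.
  move=> /andP[jl l3]; have j3 := ltn_trans jl l3.
  rewrite /B -leNgt le_eqVlt; case: eqP => //= e.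
  have [n0 l0] := sE 0%N j isT j3; have [n1 l1] := sE 1%N l isT l3.
  have jI : w j \in pts by apply: (sub 0%N j isT j3); rewrite -l0 mem_last.
  have lI : w l \in pts by apply: (sub 1%N l isT l3); rewrite -l1 mem_last.
  have lj := inj _ _ lI jI e.
  have D := dis 0%N j 1%N l isT j3 l3; have jl' : j != l by rewrite neq_ltn jl.
  suff : (polyline (v 0%N) (s 0%N j) `&` polyline (v 1%N) (s 1%N l)) (w j).
    by rewrite (D jl').
  split; first by rewrite -l0; exact: polyline_last.
  by rewrite -lj -l1; exact: polyline_last.
apply: (@K33_parity (fun i j k => N i j k) (fun i j l => M i j l)
  (fun i k => A i k) (fun j l => B j l) (fun i l => C i l)) => //=;
  by rewrite Bsym //; case: (B _ _).
Qed.

(** * From connected sets to a polygonal drawing *)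

Lemma seg_sub_ball x y (e : R) : ball x e y -> seg x y `<=` ball x e.
Proof.
move=> [/=]; rewrite /ball /= => b1 b2 q [c cI <-].
move: cI; rewrite /= in_itv /= => cI.
have shrink (a b : R) : `|a - b| < e -> `|a - (a + c * (b - a))| < e.
  move=> ab; have -> : a - (a + c * (b - a)) = c * (a - b) by ring.
  rewrite normrM ger0_norm; last lra.
  by apply: le_lt_trans ab; rewrite ler_piMl //; lra.
by split=> /=; apply: shrink.
Qed.

(* The points of [O] reachable from [x] by polylines form a relatively clopen
   subset of [O]. *)
Lemma polyline_connected (O C : set (R * R)) x y :
  open O -> C `<=` O -> connected C -> C x -> C y ->
  exists s, [/\ s != [::], last x s = y & polyline x s `<=` O].
Proof.
move=> oO CO cC Cx Cy.
pose P := [set q | exists s, [/\ s != [::], last x s = q & polyline x s `<=` O]].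
have ext q q' : P q -> seg q q' `<=` O -> P q'.
  move=> [s [s0 sq sO]] qq'; exists (rcons s q'); split.
  - by case: (s).
  - by rewrite last_rcons.
  move=> z [e]; rewrite /edges -cats1 pairmap_cat mem_cat => /orP[eI|].
    by move=> ez; apply: sO; exists e.
  by rewrite sq /= inE => /eqP -> /=; exact: qq'.
have nb q : O q -> exists2 e, 0 < e & ball q e `<=` O.
  by move=> Oq; have /nbhs_ballP := open_nbhs_nbhs (conj oO Oq).
have Px : P x.
  (* A single degenerate segment from [x] to [x], since the list may not be empty. *)
  exists [:: x]; split=> // z [e]; rewrite /= inE => /eqP -> /=.
  move=> [c _ <-]; suff -> : seg_pt x x c = x by exact: CO.
  by rewrite /seg_pt !subrr !mulr0 !addr0 -surjective_pairing.
have PO : P `<=` O by move=> q [s [s0 <- sO]]; apply: sO; exact: polyline_last.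
have oP : open P.
  rewrite openE => q Pq; have [e e0 eO] := nb q (PO q Pq).
  apply/nbhs_ballP; exists e => // q' qq'; apply: ext Pq _.
  by apply: subset_trans eO; exact: seg_sub_ball.
have oQ : open (O `\` P).
  rewrite openE => q [Oq Pq]; have [e e0 eO] := nb q Oq.
  apply/nbhs_ballP; exists e => // q' qq'; split; first exact: eO.
  move=> Pq'; apply: Pq; apply: ext Pq' _; rewrite seg_sym.
  by apply: subset_trans eO; exact: seg_sub_ball.
suff CP : C `&` P = C by move: Cy; rewrite -CP => -[].
apply: cC; first by exists x.
- by exists P.
- exists (~` (O `\` P)); first exact: open_closedC.
  apply/seteqP; split=> q [Cq]; first by move=> Pq; split=> // -[].
  by move=> OP; split=> //; apply: contrapT => nP; apply: OP; split=> //; exact: CO.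
Qed.

Lemma continuous_seg_pt x y : continuous (seg_pt x y).
Proof.
move=> c; have aff (a d : R) : {for c, continuous (fun t : R => a + t * d)}.
  by apply: cvgD; [exact: cvg_cst|apply: cvgM; [exact: cvg_id|exact: cvg_cst]].
exact: (@cvg_pair _ _ _ (nbhs c) (nbhs (seg_pt x y c).1) (nbhs (seg_pt x y c).2)
  _ _ _ _ _ (aff _ _) (aff _ _)).
Qed.

Lemma closed_seg x y : closed (seg x y).
Proof.
apply: compact_closed; first exact: norm_hausdorff.
apply: continuous_compact; last exact: segment_compact.
by apply: continuous_subspaceT; exact: continuous_seg_pt.
Qed.

Lemma closed_polyline x s : closed (polyline x s).
Proof.
have -> : polyline x s = \bigcup_(e in [set` edges x s]) seg e.1 e.2.
  by apply/seteqP; split=> q [e eI eq]; exists e.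
by apply: closed_bigcup => [|e _]; [exact: finite_seq|exact: closed_seg].
Qed.

Lemma no_K33_connected (P Q C : nat -> set (R * R)) a b p (u : nat -> R * R) :
  (forall j, [/\ open (P j), connected (P j), P j a & P j (u j)]) ->
  (forall j, [/\ open (Q j), connected (Q j), Q j b & Q j (u j)]) ->
  (forall j, [/\ connected (C j), C j p & C j (u j)]) ->
  ~ (forall j l, (j < 3)%N -> (l < 3)%N -> j != l ->
    [/\ P j `&` Q l = set0, P j `&` C l = set0 & Q j `&` C l = set0]).
Proof.
move=> HP HQ HC dis.
have /choice[sP sPE] j : exists s,
    [/\ s != [::], last a s = u j & polyline a s `<=` P j].
  by have [oP cP Pa Pu] := HP j; exact: (polyline_connected oP _ cP Pa Pu).
have /choice[sQ sQE] j : exists s,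
    [/\ s != [::], last b s = u j & polyline b s `<=` Q j].
  by have [oQ cQ Qb Qu] := HQ j; exact: (polyline_connected oQ _ cQ Qb Qu).
pose K l := \bigcup_(j in [set j | (j < 3)%N && (j != l)])
  (polyline a (sP j) `|` polyline b (sQ j)).
have /choice[sC sCE] l : exists s, (l < 3)%N ->
    [/\ s != [::], last p s = u l & polyline p s `<=` ~` K l].
  have [l3|] := boolP (l < 3)%N; last by exists [::].
  have [cC Cp Cu] := HC l.
  have [||s sE] := polyline_connected (O := ~` K l) _ _ cC Cp Cu; last by exists s.
    apply: closed_openC; apply: closed_bigcup => [|j _].
      by apply: (sub_finite_set _ (finite_II 3)) => j /= /andP[].
    by apply: closedU; exact: closed_polyline.
  move=> q Cq [j /= /andP[j3 jl]].
  have [_ PC QC] := dis j l j3 l3 jl; have [_ _ sP'] := sPE j; have [_ _ sQ'] := sQE j.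
  by case=> [/sP' Pq|/sQ' Qq];
    [have : (P j `&` C l) q by []; rewrite PC|have : (Q j `&` C l) q by []; rewrite QC].
(* The defaults of [nth] supply the third vertex [p] and its edges [sC]. *)
pose v i := nth p [:: a; b] i.
pose s i := nth sC [:: sP; sQ] i.
apply: (@K33_not_planar v u s) => [i j i3 j3|i j k l ik j3 l3 jl].
  case: i i3 => [|[|[|i]]] //= _.
  - by have [? ? _] := sPE j.
  - by have [? ? _] := sQE j.
  - by have [? ? _] := sCE j j3.
have /andP[lik k3] := ik.
case: k i lik k3 {ik} => [|[|[|k]]] [|[|i]] //= _ _.
- have [PQ _ _] := dis j l j3 l3 jl.
  rewrite -subset0 -PQ => q [Pq Qq]; split; first by have [_ _] := sPE j; apply.
  by have [_ _] := sQE l; apply.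
- rewrite -subset0 => q [Pq Cq].
  have [_ _ sK] := sCE l l3; apply: (sK q Cq); exists j => /=; last by left.
  by rewrite j3.
- rewrite -subset0 => q [Qq Cq].
  have [_ _ sK] := sCE l l3; apply: (sK q Cq); exists j => /=; last by right.
  by rewrite j3.
Qed.

End Plane.

(** * Regular closed sets: connected interiors, contact and components *)

Section RegularClosed.
Variable T : topologicalType.
Implicit Types (A B X Y Z b r s z : set T).

(** A nonempty relatively clopen part of [B] meets the dense set [A], hence contains it, and being
    relatively closed it is all of [B]. *)
Lemma connected_between A B :
  connected A -> A `<=` B -> B `<=` closure A -> connected B.
Proof.
move=> cA AB BA B' [q B'q] [C oC B'C] [D cD B'D].
have AB' : A `&` B' = A.
  apply: cA.
  - have [Bq Cq] : (B `&` C) q by rewrite -B'C.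
    have [x [Ax Cx]] := BA _ Bq C (open_nbhs_nbhs (conj oC Cq)).
    by exists x; split=> //; rewrite B'C; split=> //; exact: AB.
  - by exists C => //; rewrite B'C setIA (setIidl AB).
  - by exists D => //; rewrite B'D setIA (setIidl AB).
have AD : A `<=` D by move=> x; rewrite -AB' B'D => -[_ []].
rewrite B'D; apply/setIidl/(subset_trans BA).
by rewrite [D](iffLR (closure_id D) cD); exact: closureS.
Qed.

Lemma regclosed_meets X G :
  regclosed X -> open G -> X `&` G !=set0 -> X° `&` G !=set0.
Proof. by move=> rX oG [q []]; rewrite -{1}rX => Xq Gq; apply: Xq; exact: open_nbhs_nbhs. Qed.

Lemma regclosed_interior_neq0 X : regclosed X -> X !=set0 -> X° !=set0.
Proof.
move=> rX X0; have := @regclosed_meets X setT rX openT.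
by rewrite !setIT; exact.
Qed.

(** An open set meeting [Y] meets its interior. The boundary of [Y] is avoided as well, which serves
    for components that are not open. *)
Lemma rc_mul_eq0 X Y : regclosed Y -> rc_mul X Y = set0 -> X° `&` Y = set0.
Proof.
move=> rY XY; rewrite -subset0 => q [Xq Yq].
have [x [Yx Xx]] : Y° `&` X° !=set0.
  by apply: regclosed_meets => //; [exact: open_interior|exists q].
suff : rc_mul X Y x by rewrite XY.
by apply: subset_closure; rewrite interiorI.
Qed.

Lemma rc_mulC X Y : rc_mul X Y = rc_mul Y X.
Proof. by rewrite /rc_mul setIC. Qed.

(** The traces of [X] and [Z] on [O] lie between an interior and its closure, so both are connected,
    and they share [q]. *)
Lemma connected_interiorU X Z q : regclosed X -> regclosed Z ->
  connected X° -> connected Z° ->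
  (X `|` Z)° q -> X q -> Z q -> connected (X `|` Z)°.
Proof.
move=> rX rZ cX cZ Oq Xq Zq; set O := (X `|` Z)° in Oq *.
have part Y : regclosed Y -> connected Y° -> Y `<=` X `|` Z -> connected (O `&` Y).
  move=> rY cY sY; apply: connected_between cY _ _.
    by move=> x Yx; split; [exact: interiorS sY x Yx|exact: interior_subset].
  by rewrite rY => x [].
have -> : O = (O `&` X) `|` (O `&` Z).
  by rewrite -setIUr; apply/esym/setIidl; exact: interior_subset.
by apply: connectedU; [exists q|apply: part => // x; left|apply: part => // x; right].
Qed.

(** Without contact, [Z] and the complement of [Y] have the same trace on the connected interior.
    This trace is clopen and nonempty, yet misses the interior of [Y]. *)
Lemma connected_interior_touch Y Z : closed Y -> closed Z ->
  Y° !=set0 -> Z° !=set0 -> connected (Z `|` Y)° ->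
  exists q, [/\ (Z `|` Y)° q, Z q & Y q].
Proof.
move=> clY clZ [y Yy] [x Zx] cO; apply: contrapT => no.
have sub : (Z `|` Y)° `<=` Z `|` Y by exact: interior_subset.
have OZ : (Z `|` Y)° `&` Z = (Z `|` Y)°.
  apply: cO; last by exists Z.
    exists x; split; last exact: interior_subset.
    by apply: interiorS Zx => ?; left.
  exists (~` Y); first exact: closed_openC.
  apply/seteqP; split=> q [Oq]; first by move=> Zq; split=> // Yq; apply: no; exists q.
  by move=> nY; split=> //; case: (sub _ Oq).
have Oy : (Z `|` Y)° y by apply: interiorS Yy => ?; right.
apply: no; exists y; split=> //; last exact: interior_subset.
by move: Oy; rewrite -OZ => -[].
Qed.

(* No contact point of [X] and [z] is interior to their union, so one interior
   to [z + r + s] must be a limit of points of [s]. *)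
Lemma contact_limit X r s z p : regclosed X -> regclosed z -> closed s ->
  connected X° -> connected z° -> r `<=` X ->
  ~ connected (X `|` z)° -> (z `|` (r `|` s))° p -> z p -> r p -> s p.
Proof.
move=> rX rz cls cX cz rsub nc Op zp rp.
have nXz : ~ (X `|` z)° p.
  by move=> h; apply: nc; apply: (connected_interiorU rX rz cX cz h) => //; exact: rsub.
rewrite (iffLR (closure_id s) cls) => N Np; apply: contrapT => no.
apply: nXz; have ON : nbhs p ((z `|` (r `|` s))° `&` N).
  by apply: filterI => //; exact: open_nbhs_nbhs (conj (open_interior _) Op).
apply: filterS ON => q [/interior_subset[zq|[rq|sq]] Nq]; first by right.
- by left; exact: rsub.
- by exfalso; apply: no; exists q.
Qed.

(** A contact point of [z] with [r + s] lies in one of [r] and [s], and [contact_limit] puts it in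
    the other. *)
Lemma triple_point b r s z :
  regclosed (b `|` r) -> regclosed (b `|` s) ->
  regclosed z -> regclosed r -> closed s ->
  connected (b `|` r)° -> connected (b `|` s)° -> connected z° ->
  connected (z `|` (r `|` s))° -> z !=set0 -> r !=set0 ->
  ~ connected (b `|` r `|` z)° -> ~ connected (b `|` s `|` z)° ->
  exists p, [/\ z p, r p & s p].
Proof.
move=> rbr rbs rz rr cls cbr cbs cz cO z0 r0 nr ns.
have clr := regclosed_closed rr.
have z0' := regclosed_interior_neq0 rz z0.
have [x rx] := regclosed_interior_neq0 rr r0.
have rs0 : (r `|` s)° !=set0 by exists x; apply: interiorS rx => ?; left.
have [p [Op zp]] := connected_interior_touch (closedU clr cls)
  (regclosed_closed rz) rs0 z0' cO.
case=> h; exists p; split=> //.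
- by apply: (contact_limit rbr rz cls cbr cz _ nr Op zp h) => ?; right.
- move: Op; rewrite setUC [r `|` s]setUC [_ `|` z]setUC => Op.
  by apply: (contact_limit rbs rz clr cbs cz _ ns Op zp h) => ?; right.
Qed.

(** The other components are finitely many closed sets, so the complement of their union is a
    neighbourhood of [p] and meets the interior of [X]. This is where finiteness enters. *)
Lemma component_meets_interior X p : regclosed X -> finitely_many_components X ->
  X p -> exists2 u, X° u & connected_component X p u.
Proof.
move=> rX fX Xp.
pose F := \bigcup_(A in connected_components X `\` [set connected_component X p]) A.
have cF : closed F.
  apply: closed_bigcup => [|A [[x Xx <-] _]]; first exact: finite_setD.
  exact: component_closed (regclosed_closed rX).
have Fp : (~` F) p.
  move=> [A [[x Xx <-] ne] xp]; apply: ne => /=.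
  exact: same_connected_component.
have /= [u [Xu Fu]] : X° `&` ~` F !=set0.
  by apply: regclosed_meets => //; [exact: closed_openC|exists p].
exists u => //; have Xu' := interior_subset Xu.
have uu := connected_component_refl Xu'.
apply: contrapT => npu; apply: Fu; exists (connected_component X u) => //.
by split; [exists u|move=> /= E; apply: npu; rewrite -E].
Qed.

End RegularClosed.

(** * The formula, and its failure for finitely many components *)

Local Notation "t1 +t t2" := (TAdd t1 t2) (at level 50, left associativity).

(** The equation [z +t w = w] makes [z] a part of [w]. Disjointness is demanded for different
    letters among [r], [s], [w] only, as these give the independent edges. *)
Definition strip_formula : formula :=
  let r := TVar 0 in let s := TVar 1 in let w := TVar 2 in
  let a := TVar 3 in let b := TVar 4 in let z := TVar 5 in
  foldr FAnd (FEq TZero TZero) [::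
    FNot (FEq a TZero); FNot (FEq b TZero); FNot (FEq r TZero);
    FNot (FEq z TZero); FEq (z +t w) w;
    FIntConn (a +t r); FIntConn (a +t s); FIntConn (a +t w);
    FIntConn (b +t r); FIntConn (b +t s); FIntConn (b +t w);
    FIntConn z; FIntConn (z +t (r +t s));
    FNot (FIntConn (b +t r +t z)); FNot (FIntConn (b +t s +t z));
    FEq (TMul (a +t r) (b +t s)) TZero; FEq (TMul (a +t r) (b +t w)) TZero;
    FEq (TMul (a +t s) (b +t r)) TZero; FEq (TMul (a +t s) (b +t w)) TZero;
    FEq (TMul (a +t w) (b +t r)) TZero; FEq (TMul (a +t w) (b +t s)) TZero].

Lemma strip_formula_infinite (R : realType) (I : nat -> set (R * R)) :
  interpretation_over_RC I -> (forall n, finitely_many_components (I n)) ->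
  ~ satisfies I strip_formula.
Proof.
move=> IRC fin /=; rewrite /rc_add.
move=> [/eqP/set0P a0] [/eqP/set0P b0] [/eqP/set0P r0] [/eqP/set0P z0] [zw].
move=> [c30] [c31] [c32] [c40] [c41] [c42] [cz] [czrs] [nr] [ns].
move=> [d01] [d02] [d10] [d12] [d20] [d21] _.
have rcU i j : regclosed (I i `|` I j).
  exact: (@term_val_RC _ I (TVar i +t TVar j) IRC).
have rcl i : regclosed (I i) by exact: IRC.
have [p [zp rp sp]] := triple_point (rcU 4%N 0%N) (rcU 4%N 1%N) (rcl 5%N) (rcl 0%N)
  (regclosed_closed (rcl 1%N)) c40 c41 cz czrs z0 r0 nr ns.
have [ur ur1 ur2] := component_meets_interior (rcl 0%N) (fin 0%N) rp.
have [us us1 us2] := component_meets_interior (rcl 1%N) (fin 1%N) sp.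
have [uz uz1] := regclosed_interior_neq0 (rcl 5%N) z0.
have [ua ua1] := regclosed_interior_neq0 (rcl 3%N) a0.
have [ub ub1] := regclosed_interior_neq0 (rcl 4%N) b0.
have zsub : I 5%N `<=` I 2%N by rewrite -zw; left.
(* Indices 0, 1, 2 stand for [r], [s], [w], the last through the default of [nth]. The third set
   through [p] is [z] itself, connected as the closure of its interior. *)
pose X i := nth (I 2%N) [:: I 0%N; I 1%N] i.
pose C i := nth (I 5%N) [:: connected_component (I 0%N) p; connected_component (I 1%N) p] i.
pose u i := nth uz [:: ur; us] i.
have uX i : (X i)° (u i).
  by case: i => [|[|i]] //=; rewrite /X /u /= !nth_nil; exact: interiorS zsub uz uz1.
have CX i : C i `<=` X i.
  case: i => [|[|i]] /=; [exact: connected_component_sub|exact: connected_component_sub|].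
  by rewrite /C /X /= !nth_nil.
apply: (@no_K33_connected R (fun i => (I 3%N `|` X i)°) (fun i => (I 4%N `|` X i)°) C
  ua ub p u) => [i|i|i|i j i3 j3 ij].
- split; first exact: open_interior.
  + by case: i => [|[|i]] //=; rewrite /X /= nth_nil.
  + by apply: interiorS ua1 => ?; left.
  + by apply: interiorS (uX i) => ?; right.
- split; first exact: open_interior.
  + by case: i => [|[|i]] //=; rewrite /X /= nth_nil.
  + by apply: interiorS ub1 => ?; left.
  + by apply: interiorS (uX i) => ?; right.
- case: i => [|[|i]]; rewrite /C /u /= ?nth_nil; split=> //.
  + exact: component_connected.
  + exact: connected_component_refl.
  + exact: component_connected.
  + exact: connected_component_refl.
  + by rewrite -(rcl 5%N); exact: connected_closure.
  + exact: interior_subset.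
have rX k l : regclosed (I k `|` X l).
  by case: l => [|[|l]]; rewrite /X /= ?nth_nil; exact: rcU.
have dX k l : (k < 3)%N -> (l < 3)%N -> k != l ->
    rc_mul (I 3%N `|` X k) (I 4%N `|` X l) = set0.
  by case: k l => [|[|[|k]]] [|[|[|l]]].
have P1 := rc_mul_eq0 (rX 4%N j) (dX _ _ i3 j3 ij).
have P2 : (I 4%N `|` X i)° `&` (I 3%N `|` X j) = set0.
  by apply: rc_mul_eq0 => //; rewrite rc_mulC dX // eq_sym.
split; rewrite -subset0.
- by rewrite -P1; apply: setIS; exact: interior_subset.
- by rewrite -P1; apply: setIS; apply: subset_trans (CX j) _ => ?; right.
- by rewrite -P2; apply: setIS; apply: subset_trans (CX j) _ => ?; right.
Qed.

(** * Regions given as closures of open sets *)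

Section DenseOpen.
Variable T : topologicalType.
Implicit Types A B H O X : set T.

(** The interior lies between [H] and its closure, so an explicit dense open subset can be studied
    in its place. *)
Lemma connected_interior_dense H X :
  open H -> connected H -> H `<=` X -> X `<=` closure H -> connected X°.
Proof.
move=> oH cH HX XH; apply: connected_between cH _ _; first by rewrite -open_subsetE.
exact: subset_trans (@interior_subset _ X) XH.
Qed.

Lemma rc_mul_closure_eq0 A B :
  open A -> A `&` B = set0 -> rc_mul (closure A) (closure B) = set0.
Proof.
move=> oA AB; rewrite /rc_mul; suff -> : (closure A `&` closure B)° = set0 by exact: closure0.
rewrite -subset0 => q Oq; have [Aq Bq] := interior_subset Oq.
have [x [Ax Ox]] := Aq _ (open_nbhs_nbhs (conj (open_interior _) Oq)).
have [_ Bx] := interior_subset Ox.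
have [y] := Bx _ (open_nbhs_nbhs (conj oA Ax)).
by rewrite setIC AB => -[].
Qed.

Lemma open_disjoint_closure O A q : open O -> O `&` A = set0 -> O q -> ~ closure A q.
Proof.
move=> oO OA Oq /(_ O (open_nbhs_nbhs (conj oO Oq))) [x].
by rewrite setIC OA.
Qed.

End DenseOpen.

(** * The model with infinitely many strips *)

Section Model.
Variable R : realType.
Implicit Types (q : R * R) (e : R) (S : set R).

Lemma connected_seg (x y : R * R) : connected (seg x y).
Proof.
apply: connected_continuous_connected; first exact: segment_connected.
by apply: continuous_subspaceT; exact: continuous_seg_pt.
Qed.

(** Every point reaches [(x0, y0)] inside [H] by a vertical segment followed by a horizontal one. *)
Lemma connected_Lshape (H : set (R * R)) (x0 y0 : R) :
  (forall q t, H q -> q.2 <= t <= y0 \/ y0 <= t <= q.2 -> H (q.1, t)) ->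
  (forall q t, H q -> q.1 <= t <= x0 \/ x0 <= t <= q.1 -> H (t, y0)) ->
  connected H.
Proof.
move=> Hv Hh.
pose L q := seg q (q.1, y0) `|` seg (q.1, y0) (x0, y0).
have btw (a b c : R) : 0 <= c <= 1 ->
    a <= a + c * (b - a) <= b \/ b <= a + c * (b - a) <= a.
  move=> /andP[c0 c1]; case: (leP a b) => ab; [left|right];
  by apply/andP; split; nra.
have LH q : H q -> L q `<=` H.
  move=> Hq p [] [c cI <-]; move: cI; rewrite /= in_itv /= => cI; rewrite /seg_pt /=.
    by rewrite subrr mulr0 addr0; apply: Hv (btw _ _ _ cI).
  by rewrite subrr mulr0 addr0; apply: Hh (btw _ _ _ cI).
have -> : H = \bigcup_(q in H) L q.
  apply/seteqP; split=> q; first by move=> Hq; exists q => //; left; exact: seg_left.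
  by move=> [p Hp]; exact: LH.
apply: bigcup_connected.
  by exists (x0, y0) => q _; right; exact: seg_right.
move=> q _; apply: connectedU; try exact: connected_seg.
by exists (q.1, y0); split; [exact: seg_right|exact: seg_left].
Qed.

Lemma closure_near (A : set (R * R)) q :
  (forall e, 0 < e -> exists p, [/\ A p, `|q.1 - p.1| < e & `|q.2 - p.2| < e]) ->
  closure A q.
Proof.
move=> H B /nbhs_ballP[e /= e0 eB]; have [p [Ap p1 p2]] := H e e0.
by exists p; split=> //; apply: eB; split.
Qed.

Lemma open_fst S : open S -> open [set q : R * R | S q.1].
Proof. by move=> oS; apply: open_comp => // q _; exact: cvg_fst. Qed.

Lemma open_snd S : open S -> open [set q : R * R | S q.2].
Proof. by move=> oS; apply: open_comp => // q _; exact: cvg_snd. Qed.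

(** The closures of the next three sets interpret [a], [b] and [w]; [r], [s] and [z] are closures of
    strips. The closures for [b] and [z] touch only at [(0, -1)], whereas those for [b] and [w]
    touch along a half-line. *)
Definition upper : set (R * R) := [set q | 1 < q.2].
Definition lower_left : set (R * R) := [set q | q.1 < 0 /\ q.2 < -1].
Definition right_below : set (R * R) := [set q | 0 < q.1 /\ q.2 < 1].
Definition strip S : set (R * R) := [set q | S q.1 /\ (-1 < q.2 /\ q.2 < 1)].
Definition positive : set R := [set x | 0 < x].

Lemma open_upper : open upper.
Proof. exact: (open_snd (@open_gt R 1)). Qed.

Lemma open_lower_left : open lower_left.
Proof. exact: openI (open_fst (@open_lt R 0)) (open_snd (@open_lt R (-1))). Qed.

Lemma open_right_below : open right_below.
Proof. exact: openI (open_fst (@open_gt R 0)) (open_snd (@open_lt R 1)). Qed.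

Lemma open_strip S : open S -> open (strip S).
Proof.
move=> oS; apply: openI (open_fst oS) _.
exact: openI (open_snd (@open_gt R (-1))) (open_snd (@open_lt R 1)).
Qed.

Lemma closure_shift (A : set (R * R)) q (d1 d2 : R) : `|d1| <= 1 -> `|d2| <= 1 ->
  (forall e, 0 < e -> A (q.1 + e * d1, q.2 + e * d2)) -> closure A q.
Proof.
move=> n1 n2 H; apply: closure_near => e e0.
exists (q.1 + e / 2 * d1, q.2 + e / 2 * d2); split=> /=; first by apply: H; lra.
- have -> : q.1 - (q.1 + e / 2 * d1) = - (e / 2 * d1) by ring.
  by rewrite normrN normrM gtr0_norm; [nra|lra].
- have -> : q.2 - (q.2 + e / 2 * d2) = - (e / 2 * d2) by ring.
  by rewrite normrN normrM gtr0_norm; [nra|lra].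
Qed.

Lemma closure_upper q : 1 <= q.2 -> closure upper q.
Proof.
move=> q2; apply: (@closure_shift _ _ 0 1); rewrite ?normr0 ?normr1 //.
by move=> e e0; rewrite /upper /=; lra.
Qed.

Lemma closure_lower_left q : q.1 <= 0 -> q.2 <= -1 -> closure lower_left q.
Proof.
move=> q1 q2; apply: (@closure_shift _ _ (-1) (-1)); rewrite ?normrN1 //.
by move=> e e0; split=> /=; lra.
Qed.

Lemma closure_strip S q : closure S q.1 -> -1 < q.2 -> q.2 < 1 -> closure (strip S) q.
Proof.
move=> Sq q1 q2; apply: closure_near => e e0.
have [x [Sx xe]] := Sq _ (nbhsx_ballx q.1 e e0).
by exists (x, q.2); split=> //=; rewrite subrr normr0.
Qed.

Lemma connected_upper_strip S : open S -> connected (closure upper `|` closure (strip S))°.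
Proof.
(* Beyond the two open sets, [H] contains the points of height 1 over [S], through which the strips
   open into the half-plane. *)
move=> oS; pose H := upper `|` [set q | S q.1 /\ -1 < q.2].
have oH : open H.
  by apply: openU; [exact: open_upper|exact: openI (open_fst oS) (open_snd (@open_gt R (-1)))].
apply: (@connected_interior_dense _ H) => //.
- apply: (@connected_Lshape _ 0 2) => q t Hq tI; last by left; rewrite /upper /=; lra.
  move: Hq => [q2|[Sq q2]]; [left; rewrite /upper /= in q2 *|right; split=> //=];
  by case: tI; lra.
- move=> q [q2|[Sq q2]]; first by left; exact: subset_closure.
  have [h|h] := ltP q.2 1; last by left; exact: closure_upper.
  by right; apply: subset_closure.
- rewrite -closureU; apply: closureS; apply: setUS => q [Sq [q1 q2]]; by split.
Qed.

Lemma connected_lower_strip S : open S -> (forall x, S x -> x < 0) ->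
  connected (closure lower_left `|` closure (strip S))°.
Proof.
move=> oS Sneg; pose H := lower_left `|` [set q | S q.1 /\ q.2 < 1].
have oH : open H.
  by apply: openU; [exact: open_lower_left|exact: openI (open_fst oS) (open_snd (@open_lt R 1))].
apply: (@connected_interior_dense _ H) => //.
- apply: (@connected_Lshape _ (-1) (-2)) => q t Hq tI.
    move: Hq => [[q1 q2]|[Sq q2]]; [left|right]; split=> //=; by case: tI; lra.
  left; split=> /=; last lra.
  have q1 : q.1 < 0 by move: Hq => [[]|[/Sneg]].
  by case: tI; lra.
- move=> q [q2|[Sq q2]]; first by left; exact: subset_closure.
  have [h|h] := ltP (-1) q.2; first by right; exact: subset_closure.
  by left; apply: closure_lower_left => //; apply: ltW; exact: Sneg.
- rewrite -closureU; apply: closureS; apply: setUS => q [Sq [q1 q2]]; by split.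
Qed.

Lemma connected_upper_right : connected (closure upper `|` closure right_below)°.
Proof.
pose H := upper `|` [set q | 0 < q.1].
have oH : open H by apply: openU; [exact: open_upper|exact: open_fst (@open_gt R 0)].
apply: (@connected_interior_dense _ H) => //.
- apply: (@connected_Lshape _ 1 2) => q t Hq tI; last by left; rewrite /upper /=; lra.
  by move: Hq => [q2|q1]; [left; rewrite /upper /= in q2 *; case: tI; lra|right].
- move=> q [q2|q1]; first by left; exact: subset_closure.
  have [h|h] := ltP q.2 1; last by left; exact: closure_upper.
  by right; apply: subset_closure.
- by rewrite -closureU; apply: closureS; apply: setUS => q [].
Qed.

Lemma connected_lower_right : connected (closure lower_left `|` closure right_below)°.
Proof.
(* The half-plane contains the axis below height -1, where the two regions are glued. *)
pose H := [set q : R * R | q.2 < -1] `|` right_below.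
have oH : open H by apply: openU; [exact: open_snd (@open_lt R (-1))|exact: open_right_below].
apply: (@connected_interior_dense _ H) => //.
- apply: (@connected_Lshape _ 1 (-2)) => q t Hq tI; last by left => /=; lra.
  move: Hq => [/= q2|[q1 q2]]; [left => /=|right; split => //=]; by case: tI; lra.
- move=> q [/= q2|q2]; last by right; exact: subset_closure.
  have [h|h] := leP q.1 0; first by left; apply: closure_lower_left => //; exact: ltW.
  by right; apply: subset_closure; split=> //; lra.
- by rewrite -closureU; apply: closureS; apply: setSU => q [].
Qed.

Lemma connected_right_strip : connected (closure (strip positive))°.
Proof.
apply: (@connected_interior_dense _ (strip positive)) => //.
- exact: open_strip (@open_gt R 0).
- apply: (@connected_Lshape _ 1 0) => q t [q1 [q2 q3]] tI;
  by rewrite /strip /positive /= in q1 *; case: tI; lra.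
- exact: subset_closure.
Qed.

(** The whole open band lies in the union, its points on the axis being limits from the right. *)
Lemma connected_strips S S' :
  (forall x, x < 0 -> closure S x \/ closure S' x) ->
  connected (closure (strip positive) `|` (closure (strip S) `|` closure (strip S')))°.
Proof.
move=> SS'; pose H := strip setT.
apply: (@connected_interior_dense _ H) => //.
- exact: open_strip openT.
- by apply: (@connected_Lshape _ 0 0) => q t [_ [q2 q3]] tI; split=> //=; case: tI; lra.
- move=> q [_ [q1 q2]]; have [h|h] := ltP q.1 0.
    by right; have [h'|h'] := SS' _ h; [left|right]; exact: closure_strip.
  left; apply: closure_strip => // B /nbhs_ballP[e /= e0 eB].
  exists (q.1 + e / 2); split; first by rewrite /positive /=; lra.
  apply: eB; rewrite /ball /= opprD addrA subrr add0r normrN gtr0_norm; lra.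
- by rewrite -!closureU; apply: closureS => q [[]|[[]|[]]].
Qed.

(* The interior misses the axis, since every point of the axis is a limit of
   points of the upper half-plane, of [strip S'] or of the lower right quadrant. *)
Lemma disconnected_lower_strip S S' :
  (forall x, S x -> x < 0) -> (forall x, S' x -> x < 0) -> open S' ->
  (forall x, S x -> ~ S' x) -> (forall e, 0 < e -> exists2 x, S' x & - e < x) ->
  ~ connected (closure lower_left `|` closure (strip S) `|` closure (strip positive))°.
Proof.
move=> Sneg S'neg oS' SS' S'near; set X := _ `|` _ => cX.
pose N := upper `|` strip S' `|` [set q | 0 < q.1 /\ q.2 < -1].
have oN : open N.
  apply: openU; last exact: openI (open_fst (@open_gt R 0)) (open_snd (@open_lt R (-1))).
  by apply: openU; [exact: open_upper|exact: open_strip].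
have NX q : N q -> ~ X q.
  move=> Nq; rewrite /X -!closureU; apply: (open_disjoint_closure oN) => //.
  rewrite -subset0 => p [Np Gp] {Nq q}.
  move: Np Gp; rewrite /N /upper /strip /lower_left /positive /=.
  have Sn := Sneg p.1; have S'n := S'neg p.1; have SnS' := SS' p.1.
  move=> [[h|[h1 [h2 h3]]]|[h1 h2]] [[[g1 g2]|[g1 [g2 g3]]]|[g1 [g2 g3]]];
    try lra; try (have := S'n h1; lra); try (have := Sn g1; lra).
  by apply: SnS'.
have X0 y : ~ X° (0, y).
  move=> /nbhs_ballP[e /= e0 eX].
  have nN p : ball ((0, y) : R * R) e p -> ~ N p by move=> /eX Xp /NX.
  have near (c d : R) : `|c| < e -> `|d| < e -> ~ N (c, y + d).
    move=> ce de; apply: nN; split; rewrite /ball /= ?sub0r ?normrN //.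
    by rewrite opprD addrA subrr add0r normrN.
  have [h1|h1] := leP 1 y.
    apply: (near 0 (e / 2)); rewrite ?normr0 // ?gtr0_norm; [lra|lra|].
    by left; left; rewrite /upper /=; lra.
  have [h2|h2] := leP (-1) y; last first.
    apply: (near (e / 2) 0); rewrite ?normr0 // ?gtr0_norm; [lra|lra|].
    by right; split=> /=; lra.
  have [x S'x xe] := S'near e e0; have x0 := S'neg x S'x.
  (* The strip is open, so the point is raised slightly in case [y] is -1, while staying below 1. *)
  have [d [d0 de d1]] : exists d, [/\ 0 < d, d < e & y + d < 1].
    have [h|h] := leP e (1 - y).
      by exists (e / 2); split; lra.
    by exists ((1 - y) / 2); split; lra.
  apply: (near x d); [rewrite ltr0_norm //; lra|by rewrite gtr0_norm|].
  by left; right; split=> //=; lra.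
have in_X A q : open A -> A q -> A `<=` X -> X° q.
  by move=> oA Aq AX; exact: (interiorS AX) (open_nbhs_nbhs (conj oA Aq)).
have XL : X° (-1, -2).
  apply: in_X open_lower_left _ _; first by split=> /=; lra.
  by apply: subset_trans (@subset_closure _ _) _ => ? ?; left; left.
have XR : X° (1, 0).
  apply: in_X (open_strip (@open_gt R 0)) _ _; first by split=> /=; lra.
  by apply: subset_trans (@subset_closure _ _) _ => ? ?; right.
suff XE : X° `&` [set q | q.1 < 0] = X°.
  by move: XR; rewrite -XE => -[_ /=]; lra.
apply: cX.
- by exists (-1, -2); split=> //=; lra.
- by exists [set q | q.1 < 0] => //; exact: open_fst (@open_lt R 0).
- exists (~` [set q | 0 < q.1]); first by apply: open_closedC; exact: open_fst (@open_gt R 0).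
  apply/seteqP; split=> -[x y] [Xq /= h]; split=> //=; first lra.
  have [x0|x0|x0] := ltgtP x 0 => //.
  by move: Xq; rewrite x0 => /X0.
Qed.

(** * Alternating intervals accumulating at 0 *)

(** The interval from [-1/k] to [-1/(k+1)], unbounded on the left for [k = 0], written without
    division. *)
Definition gap (k : nat) : set R := [set x | k%:R * - x < 1 /\ 1 < k.+1%:R * - x].
Definition odd_gaps : set R := \bigcup_n gap (2 * n + 1)%N.
(** Taking a complement makes it immediate that the closures of both families cover the negative
    numbers; [gap_even] recovers the gaps of even index. *)
Definition even_gaps : set R := [set x | x < 0] `\` closure odd_gaps.

Lemma gap_lt0 k x : gap k x -> x < 0.
Proof.
move=> [_ h]; rewrite ltNge; apply/negP => x0.
have : 0 <= k.+1%:R :> R by []; nra.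
Qed.

Lemma gap_inj k l x : gap k x -> gap l x -> k = l.
Proof.
suff le i j : gap i x -> gap j x -> (i <= j)%N.
  by move=> kx lx; apply/eqP; rewrite eqn_leq !le.
move=> ix [_ jx]; have x0 : 0 < - x by rewrite oppr_gt0 (gap_lt0 ix).
by move: ix => [ix _]; rewrite -ltnS -(ltr_nat R) -(ltr_pM2r x0) (lt_trans ix).
Qed.

Lemma open_gap k : open (gap k).
Proof.
have cont (j : nat) : continuous (fun x : R => j%:R * - x).
  by move=> x; apply: cvgM; [exact: cvg_cst|apply: cvgN; exact: cvg_id].
by apply: openI; [apply: (open_comp _ (@open_lt R 1))|
  apply: (open_comp _ (@open_gt R 1))] => x _; exact: cont.
Qed.

Lemma open_odd_gaps : open odd_gaps.
Proof. by apply: bigcup_open => n _; exact: open_gap. Qed.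

Lemma open_even_gaps : open even_gaps.
Proof. by apply: openI; [exact: open_lt|apply: closed_openC; exact: closed_closure]. Qed.

Lemma odd_gaps_lt0 x : odd_gaps x -> x < 0.
Proof. by move=> [n _]; exact: gap_lt0. Qed.

Lemma even_gaps_lt0 x : even_gaps x -> x < 0.
Proof. by case. Qed.

Lemma gap_even n x : gap (2 * n)%N x -> even_gaps x.
Proof.
move=> nx; split; first exact: gap_lt0 nx.
apply: (open_disjoint_closure (@open_gap (2 * n)%N) _ nx).
by rewrite -subset0 => y [ny [k _ /(gap_inj ny)]]; lia.
Qed.

Lemma gap_near e (k : nat) : 0 < e -> (Num.bound e^-1 <= k)%N ->
  exists2 x, gap k x & - e < x.
Proof.
move=> e0 nk; have k0 : 0 <= k%:R :> R by [].
have ek : 1 < e * (k%:R + 2^-1).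
  have : e^-1 < k%:R.
    by apply: lt_le_trans (archi_boundP _) _; rewrite ?ler_nat // invr_ge0 ltW.
  by rewrite -div1r ltr_pdivrMr // mulrC; lra.
have h0 : 0 < k%:R + 2^-1 :> R by lra.
(* A point [x] is in [gap k] when [-1/x] lies between [k] and [k+1]; the midpoint is taken. *)
exists (- (k%:R + 2^-1)^-1).
  by rewrite /gap /= opprK ltr_pdivrMr // ltr_pdivlMr // -(natr1 k); split; lra.
by rewrite ltrN2 -div1r ltr_pdivrMr.
Qed.

Lemma odd_gaps_near e : 0 < e -> exists2 x, odd_gaps x & - e < x.
Proof.
move=> e0; have [|x nx ex] := @gap_near e (2 * Num.bound e^-1 + 1)%N e0; first lia.
by exists x => //; exists (Num.bound e^-1).
Qed.

Lemma even_gaps_near e : 0 < e -> exists2 x, even_gaps x & - e < x.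
Proof.
move=> e0; have [|x nx ex] := @gap_near e (2 * Num.bound e^-1)%N e0; first lia.
by exists x => //; exact: gap_even nx.
Qed.

Lemma odd_even_gaps x : odd_gaps x -> ~ even_gaps x.
Proof. by move=> ox [_]; apply; exact: subset_closure. Qed.

Definition strips_interpretation (n : nat) : set (R * R) :=
  closure (nth set0 [:: strip odd_gaps; strip even_gaps; right_below; upper;
                        lower_left; strip positive] n).

Lemma strips_interpretation_RC : interpretation_over_RC strips_interpretation.
Proof.
move=> n; apply: closure_open_regclosed.
case: n => [|[|[|[|[|[|n]]]]]] /=; rewrite ?nth_nil.
- exact: open_strip open_odd_gaps.
- exact: open_strip open_even_gaps.
- exact: open_right_below.
- exact: open_upper.
- exact: open_lower_left.
- exact: open_strip (@open_gt R 0).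
- exact: open0.
Qed.

Lemma strips_satisfy : satisfies strips_interpretation strip_formula.
Proof.
have neq0 (A : set (R * R)) q : A q -> closure A <> set0.
  by move=> Aq; apply/eqP/set0P; exists q; exact: subset_closure.
have oo := open_odd_gaps; have oe := open_even_gaps.
have on := odd_gaps_lt0; have en := even_gaps_lt0.
have [x0 ox0 _] := odd_gaps_near (@ltr01 R).
rewrite /= /strips_interpretation /rc_add /=.
do ![split].
- by apply: (neq0 _ (0, 2)); rewrite /upper /=; lra.
- by apply: (neq0 _ (-1, -2)); split=> /=; lra.
- by apply: (neq0 _ (x0, 0)); split=> //=; lra.
- by apply: (neq0 _ (1, 0)); split=> /=; rewrite ?/positive /=; lra.
- by apply/setUidr/closureS => q [q1 [q2 q3]]; split.
- exact: connected_upper_strip.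
- exact: connected_upper_strip.
- exact: connected_upper_right.
- exact: connected_lower_strip.
- exact: connected_lower_strip.
- exact: connected_lower_right.
- exact: connected_right_strip.
- apply: connected_strips => x x0'; have [|nx] := pselect (closure odd_gaps x); first by left.
  by right; exact: subset_closure.
- apply: (disconnected_lower_strip (S' := even_gaps)) => //; first exact: odd_even_gaps.
  exact: even_gaps_near.
- apply: (disconnected_lower_strip (S' := odd_gaps)) => //.
    by move=> x ex /odd_even_gaps.
  exact: odd_gaps_near.
all: rewrite -!closureU; apply: rc_mul_closure_eq0;
  first by apply: openU; [exact: open_upper|exact: open_strip || exact: open_right_below].
all: rewrite -subset0 => q; rewrite /upper /strip /right_below /lower_left /=;
  have qo := on q.1; have qe := en q.1; have oe' := @odd_even_gaps q.1;
  (move=> [[h|[h1 h2]]] [[g1 g2]|[g1 g2]]; try lra;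
   try (have := qo h1; lra); try (have := qe h1; lra);
   try (have := qo g1; lra); try (have := qe g1; lra)).
(* The signs leave only an odd strip against an even one. *)
all: by [apply: oe'|exact: (oe' g1)].
Qed.

End Model.

Theorem theorem2 (R : realType) :
  exists phi : formula,
    satisfiable_over_RC (R * R)%type phi /\
    ~ (exists I : nat -> set (R * R)%type,
         interpretation_over_RC I /\
         (forall n : nat, finitely_many_components (I n)) /\
         satisfies I phi).
Proof.
exists strip_formula; split.
  exists (@strips_interpretation R).
  by split; [exact: strips_interpretation_RC|exact: strips_satisfy].
by move=> [I [IRC [fin sat]]]; exact: strip_formula_infinite IRC fin sat.
Qed.
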